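(* Let $L(a,b)=\dfrac{b-a}{\log b-\log a}$ for $a,b>0$, $a\ne b$, with $L(a,a)=a$, be the logarithmic mean, and let $L_3(a,b,c)$ be the invariant logarithmic mean, i.e. the unique symmetric mean in three variables satisfying $L_3(L(a,c),L(a,b),L(b,c))=L_3(a,b,c)$ for all $(a,b,c)\in\mathbb{R}_+^3$. Then $L_3$ is not type 2 invariant with respect to $L$; that is, it is not the case that $L_3(a,b,L(a,b))=L(a,b)$ for all $(a,b)\in\mathbb{R}_+^2$.
   Context: $\mathbb{R}_+^n=\{(a_1,\dots,a_n)\in\mathbb{R}^n: a_i>0\ \forall i\}$. A mean in $n$ variables is a continuous function $m$ on $\mathbb{R}_+^n$ with $\min(a_1,\dots,a_n)\le m(a_1,\dots,a_n)\le\max(a_1,\dots,a_n)$; it is symmetric if it is unchanged by every permutation of its arguments. The mean $L$ is strict (equal to the min or max of its arguments only when they coincide) and increasing in each variable, and for any such symmetric mean $m$ in two variables there is exactly one symmetric mean $M$ in three variables with $M(m(a,c),m(a,b),m(b,c))=M(a,b,c)$ for all $a,b,c>0$; it is the common limit of the sequences $a_{n+1}=m(a_n,c_n)$, $c_{n+1}=m(a_n,b_n)$, $b_{n+1}=m(c_n,b_n)$ with $(a_0,b_0,c_0)=(a,b,c)$. *)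

(* Defs.v *)
From mathcomp Require Import all_boot all_order all_algebra all_fingroup.
From mathcomp Require Import all_classical all_reals all_analysis.
Set Implicit Arguments.
Unset Strict Implicit.
Unset Printing Implicit Defensive.
Import Order.TTheory GRing.Theory Num.Theory.
Import numFieldNormedType.Exports.
Local Open Scope classical_set_scope.
Local Open Scope ring_scope.

Definition pos_orthant (R : realType) (n : nat) : set 'rV[R]_n :=
  [set a | forall i, 0 < a ord0 i].

(* The index element [a ord0 ord0] of both big operators is itself an entry of
   [a], so they are exactly the minimum and the maximum of the entries. *)
Definition row_min (R : realType) (n : nat) (a : 'rV[R]_n.+1) : R :=
  \big[Num.min/a ord0 ord0]_i a ord0 i.

Definition row_max (R : realType) (n : nat) (a : 'rV[R]_n.+1) : R :=
  \big[Num.max/a ord0 ord0]_i a ord0 i.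

(* Means live on the open positive orthant; since functions are total, the
   values of [m] elsewhere are unconstrained. *)
Definition is_mean (R : realType) (n : nat) (m : 'rV[R]_n.+1 -> R) : Prop :=
  {within @pos_orthant R n.+1, continuous m} /\
  forall a, pos_orthant a -> row_min a <= m a <= row_max a.

Definition is_symmetric (R : realType) (n : nat) (m : 'rV[R]_n -> R) : Prop :=
  forall (s : 'S_n) (a : 'rV[R]_n), pos_orthant a -> m (col_perm s a) = m a.

Definition is_symmetric_mean (R : realType) (n : nat)
    (m : 'rV[R]_n.+1 -> R) : Prop :=
  is_mean m /\ is_symmetric m.

Definition vec3 (R : realType) (a b c : R) : 'rV[R]_3 :=
  \row_(i < 3) [:: a; b; c]`_i.

Definition log_mean (R : realType) (a b : R) : R :=
  if a == b then a else (b - a) / (ln b - ln a).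

Definition invariant_under (R : realType) (m : R -> R -> R)
    (M : 'rV[R]_3 -> R) : Prop :=
  forall a b c : R, 0 < a -> 0 < b -> 0 < c ->
    M (vec3 (m a c) (m a b) (m b c)) = M (vec3 a b c).

Definition is_invariant_log_mean (R : realType) (M : 'rV[R]_3 -> R) : Prop :=
  is_symmetric_mean M /\ invariant_under (@log_mean R) M.

Definition type2_invariant (R : realType) (m : R -> R -> R)
    (M : 'rV[R]_3 -> R) : Prop :=
  forall a b : R, 0 < a -> 0 < b -> M (vec3 a b (m a b)) = m a b.

(* Main.v *)
Require Import Defs.
From mathcomp Require Import all_boot all_order all_algebra all_fingroup.
From mathcomp Require Import all_classical all_reals all_analysis.
From mathcomp Require Import ring lra.
Set Implicit Arguments.
Unset Strict Implicit.
Unset Printing Implicit Defensive.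
Import Order.TTheory GRing.Theory Num.Theory.
Local Open Scope ring_scope.

(** A mean is bounded below by the minimum of its arguments, so by invariance
    [L3 (a, b, c)] is at least the minimum of every iterate of [(a, b, c)].
    Take [b = 1] and [a = exp (- exp 31)], so that [c = L a b] is slightly
    less than [exp (- 31)].  Since [L p q] decays only like [q / log (q / p)]
    as [p] tends to 0, the iteration soon lifts all three arguments above [c]:
    after three steps they are at least [exp (- 19)].  Hence
    [L3 (a, b, L a b) > L a b]. *)

(** This is [ln (1 + u) <= u] at [u = q / p - 1], scaled by [p]. *)
Lemma ln_sub_le (R : realType) (p q : R) : 0 < p -> 0 < q ->
  p * (ln q - ln p) <= q - p.
Proof.
move=> p0 q0; rewrite -ln_div ?posrE// mulrC -ler_pdivlMr// mulrBl divff ?gt_eqF//.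
have := @le_ln1Dx R (q / p - 1); rewrite addrCA subrr addr0; apply.
by rewrite ltrBrDr addNr divr_gt0.
Qed.

Lemma log_meanC (R : realType) (p q : R) : log_mean p q = log_mean q p.
Proof.
rewrite /log_mean eq_sym; case: eqP => // _.
by rewrite -(opprB p q) -(opprB (ln p) (ln q)) invrN mulrNN.
Qed.

Lemma log_mean_ltE (R : realType) (p q : R) : p < q ->
  log_mean p q = (q - p) / (ln q - ln p).
Proof. by move=> pq; rewrite /log_mean lt_eqF. Qed.

Lemma log_mean_le_max (R : realType) (p q : R) : 0 < p -> p <= q ->
  log_mean p q <= q.
Proof.
move=> p0; rewrite le_eqVlt => /predU1P[->|pq]; first by rewrite /log_mean eqxx.
have q0 := lt_trans p0 pq.
rewrite log_mean_ltE// ler_pdivrMr ?subr_gt0 ?ltr_ln//.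
have := ln_sub_le q0 p0; lra.
Qed.

Lemma log_mean_ge_min (R : realType) (p q : R) : 0 < p -> p <= q ->
  p <= log_mean p q.
Proof.
move=> p0; rewrite le_eqVlt => /predU1P[->|pq]; first by rewrite /log_mean eqxx.
have q0 := lt_trans p0 pq.
by rewrite log_mean_ltE// ler_pdivlMr ?subr_gt0 ?ltr_ln// ln_sub_le.
Qed.

(* The slope of the concave function [ln] over [[p, q]] and [[q, r]] is
   separated by its derivative [1 / q]. *)
Lemma ln_slope_le (R : realType) (p q r : R) : 0 < p -> p < q -> q < r ->
  (q - p) * (ln r - ln q) <= (r - q) * (ln q - ln p).
Proof.
move=> p0 pq qr; have q0 := lt_trans p0 pq; have r0 := lt_trans q0 qr.
(* After scaling by [q], the product [(q - p) * (r - q)] lies between the two sides. *)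
rewrite -(ler_pM2l q0).
have := ler_wpM2l (ltW (etrans (subr_gt0 _ _) pq)) (ln_sub_le q0 r0).
have := ler_wpM2l (ltW (etrans (subr_gt0 _ _) qr)) (ln_sub_le q0 p0).
lra.
Qed.

(** If [p] lies between [q] and [r], it separates the two means. Otherwise the means are inverse
    slopes of chords of [ln] through [p], compared by concavity. *)
Lemma log_mean_ler (R : realType) (p q r : R) : 0 < p -> 0 < q -> q <= r ->
  log_mean p q <= log_mean p r.
Proof.
move=> p0 q0; rewrite le_eqVlt => /predU1P[->//|qr]; have r0 := lt_trans q0 qr.
have [qp|pq] := leP q p.
  have [pr|rp] := leP p r.
    rewrite log_meanC (le_trans (log_mean_le_max q0 qp))//.
    exact: log_mean_ge_min.
  have qp' := lt_trans qr rp.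
  rewrite ![log_mean p _]log_meanC !log_mean_ltE//.
  rewrite ler_pdivrMr ?subr_gt0 ?ltr_ln// mulrAC ler_pdivlMr ?subr_gt0 ?ltr_ln//.
  have := ln_slope_le q0 qr rp; lra.
have pr := lt_trans pq qr.
rewrite !log_mean_ltE//.
rewrite ler_pdivrMr ?subr_gt0 ?ltr_ln// mulrAC ler_pdivlMr ?subr_gt0 ?ltr_ln//.
have := ln_slope_le p0 pq qr; lra.
Qed.

Lemma log_mean_le (R : realType) (p p' q q' : R) :
  0 < p -> p <= p' -> 0 < q -> q <= q' -> log_mean p q <= log_mean p' q'.
Proof.
move=> p0 pp' q0 qq'; apply: (le_trans (log_mean_ler p0 q0 qq')).
by rewrite ![log_mean _ q']log_meanC log_mean_ler// (lt_le_trans q0).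
Qed.

Lemma log_mean_expR (R : realType) (s t : R) : t < s ->
  log_mean (expR (- s)) (expR (- t)) = (expR (- t) - expR (- s)) / (s - t).
Proof.
by move=> ts; rewrite log_mean_ltE ?ltr_expR ?ltrN2// !expRK opprK [- t + s]addrC.
Qed.

Lemma le2_expR1 (R : realType) : 2 <= expR 1 :> R.
Proof. by have := @expR_ge1Dx R 1; lra. Qed.

Lemma expR_natN_le (R : realType) (n : nat) : 2 ^+ n <= expR n%:R :> R.
Proof.
elim: n => [|n IHn]; first by rewrite expr0 expR0.
by rewrite exprS -[in expR _]nat1r expRD ler_pM ?exprn_ge0// le2_expR1.
Qed.

(** The engine of the estimate: one mean costs at most [j] in the exponent of the larger bound. By
    monotonicity take [p = expR (- s)] and [q = expR (- t)]; a gap [s - t >= 1] gives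
    [q - p >= q / 2], so the mean is at least [q / (2 * (s - t))]. *)
Lemma expR_le_log_mean (R : realType) (s t j p q : R) :
  1 <= s - t -> 2 * (s - t) <= expR j ->
  expR (- s) <= p -> expR (- t) <= q -> expR (- (t + j)) <= log_mean p q.
Proof.
move=> st1 stj sp tq.
have ts : t < s by lra.
apply: le_trans (log_mean_le (expR_gt0 _) sp (expR_gt0 _) tq).
rewrite log_mean_expR// ler_pdivlMr; last by lra.
have tj : expR (- t) = expR (- (t + j)) * expR j.
  by rewrite -expRD; congr expR; ring.
have half : 2 * expR (- s) <= expR (- t).
  apply: (@le_trans _ _ (expR 1 * expR (- s))).
    by rewrite ler_wpM2r ?expR_ge0// le2_expR1.
  by rewrite -expRD ler_expR; lra.
have := ler_wpM2l (expR_ge0 (- (t + j))) stj.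
rewrite -tj; lra.
Qed.

Lemma pos_orthant_vec3 (R : realType) (a b c : R) :
  0 < a -> 0 < b -> 0 < c -> pos_orthant (vec3 a b c).
Proof. by move=> a0 b0 c0 i; rewrite mxE; case: i => -[|[|[|]]]. Qed.

Lemma le_row_min_vec3 (R : realType) (z a b c : R) :
  z <= a -> z <= b -> z <= c -> z <= row_min (vec3 a b c).
Proof.
move=> za zb zc; apply/bigmin_geP; split; first by rewrite mxE.
by move=> i _; rewrite mxE; case: i => -[|[|[|]]].
Qed.

Theorem mainTheorem7 (R : realType) (L3 : 'rV[R]_3 -> R)
    (L3_invariant : is_invariant_log_mean L3) :
  ~ type2_invariant (@log_mean R) L3.
Proof.
case: L3_invariant => -[[_ L3_bounds] _] L3_inv L3_type2.
have pow2 n : 2 ^+ n <= expR n%:R :> R by exact: expR_natN_le.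
pose a : R := expR (- expR 31).
have e31 : 2 ^+ 31 <= expR 31 :> R by exact: pow2.
have e32 : 2 * expR 31 <= expR 32 :> R.
  have -> : 32 = 1 + 31 :> R by ring.
  by rewrite (expRD 1 31) ler_wpM2r ?expR_ge0// le2_expR1.
have e6 : 64 <= expR 6 :> R by apply: le_trans (pow2 6); lra.
have e7 : 128 <= expR 7 :> R by apply: le_trans (pow2 7); lra.
have one_ge : expR (- 0) <= 1 :> R by rewrite oppr0 expR0.
set c := log_mean a 1.
(* Exponents stay unevaluated, here and below, to match the shape [t + j]. *)
have c_ge : expR (- (0 + 32)) <= c.
  by apply: (@expR_le_log_mean _ (expR 31)) => //; lra.
(* Here [c = (1 - a) / expR 31], and the numerator is at most 1. *)
have c_le : c <= expR (- 31).
  have -> : c = (expR (- 0) - a) / (expR 31 - 0).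
    by rewrite -log_mean_expR ?oppr0 ?expR0//; lra.
  rewrite subr0 oppr0 expR0 expRN ler_piMl ?invr_ge0 ?expR_ge0//.
  by rewrite lerBlDr lerDl expR_ge0.
set x := log_mean a c.
have x_ge : expR (- (32 + 32)) <= x.
  apply: (@expR_le_log_mean _ (expR 31)) => //; try lra.
  by rewrite -[32]add0r.
set y := log_mean 1 c.
have y_ge : expR (- (0 + 6)) <= y.
  rewrite /y log_meanC; apply: (@expR_le_log_mean _ (0 + 32)) => //; lra.
have a0 : 0 < a by exact: expR_gt0.
have c0 := lt_le_trans (expR_gt0 _) c_ge.
have x0 := lt_le_trans (expR_gt0 _) x_ge.
have y0 := lt_le_trans (expR_gt0 _) y_ge.
(* Weakened to the bound on [x], so that [x] and [c] pair with [y] alike: the gap is 64 - 6 = 58,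
   and 2 * 58 <= 128 <= [expR 7]. *)
have c_ge' : expR (- (32 + 32)) <= c.
  by apply: le_trans c_ge; rewrite ler_expR; lra.
have xy_ge : expR (- (0 + 6 + 7)) <= log_mean x y.
  by apply: (@expR_le_log_mean _ (32 + 32)) => //; lra.
have cy_ge : expR (- (0 + 6 + 7)) <= log_mean c y.
  by apply: (@expR_le_log_mean _ (32 + 32)) => //; lra.
have xc_ge : expR (- (0 + 32 + 6)) <= log_mean x c.
  by apply: (@expR_le_log_mean _ (32 + 32)) => //; lra.
have xy0 := lt_le_trans (expR_gt0 _) xy_ge.
have cy0 := lt_le_trans (expR_gt0 _) cy_ge.
have xc0 := lt_le_trans (expR_gt0 _) xc_ge.
(* The gap is 38 - 13 = 25, and 2 * 25 <= 64 <= [expR 6]. *)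
have last_ge (p q : R) : expR (- (0 + 32 + 6)) <= p -> expR (- (0 + 6 + 7)) <= q ->
    expR (- (0 + 6 + 7 + 6)) <= log_mean p q.
  by move=> pge qge; apply: (expR_le_log_mean _ _ pge qge); lra.
have xy_ge' : expR (- (0 + 32 + 6)) <= log_mean x y.
  by apply: le_trans xy_ge; rewrite ler_expR; lra.
have v1_ge := last_ge _ _ xy_ge' cy_ge.
have v2_ge := last_ge _ _ xc_ge xy_ge.
have v3_ge := last_ge _ _ xc_ge cy_ge.
have := L3_type2 a 1 a0 ltr01.
(* Three iterations: the first turns [(a, 1, c)] into [(x, c, y)], in which [c] reappears as
   [log_mean a 1]. *)
rewrite -/c -L3_inv// -/c -/x -/y -L3_inv// -L3_inv//.
rewrite [log_mean (log_mean x y) (log_mean x c)]log_meanC.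
set v := vec3 _ _ _ => L3v.
have /L3_bounds /andP[v_min _] : pos_orthant v.
  by apply: pos_orthant_vec3; apply: lt_le_trans (expR_gt0 _) _; eassumption.
have := le_trans (le_row_min_vec3 v1_ge v2_ge v3_ge) v_min.
(* This leaves [expR (- 19) <= expR (- 31)], which is absurd. *)
rewrite L3v => /le_trans /(_ c_le).
by rewrite ler_expR; lra.
Qed.
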